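(* Let $p, M \ge 1$ be integers, let $\mathbf{Y}\in\mathbb{R}^{3p^2\times M}$, let $\sigma_r,\sigma_g,\sigma_b>0$, and let $\mathbf{W}\in\mathbb{R}^{3p^2\times 3p^2}$ be the block-diagonal matrix $\mathbf{W}=\mathrm{diag}(\sigma_r^{-1}\mathbf{I},\sigma_g^{-1}\mathbf{I},\sigma_b^{-1}\mathbf{I})$, where $\mathbf{I}$ is the $p^2\times p^2$ identity matrix. Let $\bm{w}=(w_1,\dots,w_n)$, $n=\min(3p^2,M)$, be a vector of nonnegative weights in non-descending order, i.e. $0\le w_1\le w_2\le\cdots\le w_n$. Let $\rho_0>0$ and $\mu>1$, and let $\{\mathbf{X}_k\}_{k\ge 0}$, $\{\mathbf{Z}_k\}_{k\ge 0}$, $\{\mathbf{A}_k\}_{k\ge 0}$ be sequences in $\mathbb{R}^{3p^2\times M}$ generated by the ADMM iteration for MC-WNNM described in the context, with data $\mathbf{Y},\mathbf{W},\bm{w},\rho_0,\mu$ and run for infinitely many iterations. Then (a) $\lim_{k\to\infty}\|\mathbf{X}_{k+1}-\mathbf{Z}_{k+1}\|_F=0$; (b) $\lim_{k\to\infty}\|\mathbf{X}_{k+1}-\mathbf{X}_k\|_F=0$; (c) $\lim_{k\to\infty}\|\mathbf{Z}_{k+1}-\mathbf{Z}_k\|_F=0$.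
   Context: For a matrix $\mathbf{Z}\in\mathbb{R}^{3p^2\times M}$ let $\sigma_1(\mathbf{Z})\ge\sigma_2(\mathbf{Z})\ge\cdots\ge\sigma_n(\mathbf{Z})\ge 0$ be its singular values in non-increasing order, $n=\min(3p^2,M)$. For a weight vector $\bm{w}=(w_1,\dots,w_n)$ with $w_i\ge 0$, the weighted nuclear norm is $\|\mathbf{Z}\|_{\bm{w},*}=\sum_{i=1}^n w_i\sigma_i(\mathbf{Z})$ (it is not convex in general). $\|\cdot\|_F$ is the Frobenius norm. The multi-channel weighted nuclear norm minimization (MC-WNNM) problem is $\min_{\mathbf{X}}\|\mathbf{W}(\mathbf{Y}-\mathbf{X})\|_F^2+\|\mathbf{X}\|_{\bm{w},*}$, rewritten as $\min_{\mathbf{X},\mathbf{Z}}\|\mathbf{W}(\mathbf{Y}-\mathbf{X})\|_F^2+\|\mathbf{Z}\|_{\bm{w},*}$ subject to $\mathbf{X}=\mathbf{Z}$. ADMM iteration for MC-WNNM: start from $\mathbf{X}_0=\mathbf{Z}_0=\mathbf{A}_0=\mathbf{0}$ and $\rho_0>0$. For $k=0,1,2,\dots$ perform: 1. $\mathbf{X}_{k+1}=(\mathbf{W}^\top\mathbf{W}+\tfrac{\rho_k}{2}\mathbf{I})^{-1}(\mathbf{W}^\top\mathbf{W}\mathbf{Y}+\tfrac{\rho_k}{2}\mathbf{Z}_k-\tfrac12\mathbf{A}_k)$, where here $\mathbf{I}$ is the $3p^2\times 3p^2$ identity matrix; 2. $\mathbf{Z}_{k+1}$ is a global minimizer over $\mathbf{Z}\in\mathbb{R}^{3p^2\times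 M}$ of $\tfrac{\rho_k}{2}\|\mathbf{Z}-(\mathbf{X}_{k+1}+\rho_k^{-1}\mathbf{A}_k)\|_F^2+\|\mathbf{Z}\|_{\bm{w},*}$; 3. $\mathbf{A}_{k+1}=\mathbf{A}_k+\rho_k(\mathbf{X}_{k+1}-\mathbf{Z}_{k+1})$; 4. $\rho_{k+1}=\mu\rho_k$. The weight vector $\bm{w}$ is the same in every iteration. *)

(* Defs.v *)
From mathcomp Require Import all_boot all_order all_algebra.
From mathcomp Require Import polyrcf.
From mathcomp Require Import all_classical all_reals all_analysis.
Export numFieldNormedType.Exports.
Export Order.TTheory GRing.Theory Num.Theory.

Set Implicit Arguments.
Unset Strict Implicit.
Unset Printing Implicit Defensive.

Local Open Scope ring_scope.

Definition frobenius (R : realType) (m n : nat) (Z : 'M[R]_(m, n)) : R :=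
  Num.sqrt (\sum_i \sum_j Z i j ^+ 2).

(* [rootsR] lists every root once, hence the repetition by multiplicity. *)
Definition real_eigenvalues (R : realType) (n : nat) (A : 'M[R]_n) : seq R :=
  flatten [seq nseq (mup x (char_poly A)) x | x <- rootsR (char_poly A)].

(* Z^T Z is symmetric positive semidefinite, so its n eigenvalues are all real
   and nonnegative.  When m < n, the last n - m entries are zero. *)
Definition singular_values (R : realType) (m n : nat) (Z : 'M[R]_(m, n)) :
    seq R :=
  sort >=%R [seq Num.sqrt x | x <- real_eigenvalues (Z^T *m Z)].

(* [nth] counts from 0: index i stands for the (i+1)-st largest value. *)
Definition singular_value (R : realType) (m n : nat) (Z : 'M[R]_(m, n))
    (i : nat) : R :=
  nth 0 (singular_values Z) i.

Definition weighted_nuclear_norm (R : realType) (m n : nat)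
    (w : 'rV[R]_(minn m n)) (Z : 'M[R]_(m, n)) : R :=
  \sum_(i < minn m n) w 0 i * singular_value Z i.

Definition is_global_minimizer (R : realType) (T : Type) (f : T -> R) (x : T) :
    Prop :=
  forall y : T, f x <= f y.

Lemma three_channels (d : nat) : (d + (d + d) = 3 * d)%N.
Proof. by rewrite !mulSn mul0n addn0. Qed.

Definition channel_weight_mx (R : realType) (p : nat) (sr sg sb : R) :
    'M[R]_(3 * p ^ 2) :=
  castmx (three_channels (p ^ 2), three_channels (p ^ 2))
    (block_mx (sr^-1)%:M 0
              0 (block_mx (sg^-1)%:M 0
                          0 (sb^-1)%:M)).

Record admm_iteration (R : realType) (m n : nat) (Y : 'M[R]_(m, n))
    (W : 'M[R]_m) (w : 'rV[R]_(minn m n)) (rho0 mu : R)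
    (X Z A : nat -> 'M[R]_(m, n)) (rho : nat -> R) : Prop := AdmmIteration {
  admm_X0 : X 0%N = 0;
  admm_Z0 : Z 0%N = 0;
  admm_A0 : A 0%N = 0;
  admm_rho0 : rho 0%N = rho0;
  admm_X : forall k : nat,
    X k.+1 = invmx (W^T *m W + (rho k / 2)%:M) *m
             (W^T *m W *m Y + (rho k / 2) *: Z k - 2^-1 *: A k);
  admm_Z : forall k : nat,
    is_global_minimizer
      (fun V : 'M[R]_(m, n) =>
         rho k / 2 * frobenius (V - (X k.+1 + (rho k)^-1 *: A k)) ^+ 2
         + weighted_nuclear_norm w V)
      (Z k.+1);
  admm_A : forall k : nat, A k.+1 = A k + rho k *: (X k.+1 - Z k.+1);
  admm_rho : forall k : nat, rho k.+1 = mu * rho k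
}.

(* Main.v *)
(* Weyl's inequality makes the weighted nuclear norm Lipschitz, with constant
   L = w_1 + ... + w_n, although it is not convex.  Put
   D = X_{k+1} + A_k / rho_k.  Comparing the minimizer Z_{k+1} with D gives
   rho_k / 2 |D - Z_{k+1}|^2 <= L |D - Z_{k+1}|, that is
   |A_{k+1}| = rho_k |D - Z_{k+1}| <= 2 L: the multipliers are bounded, whence
   X_{k+1} - Z_{k+1} = (A_{k+1} - A_k) / rho_k = O(1 / rho_k).
   As W^T W is diagonal, the X-update is scalar in each entry and
   |Z_{k+1}| <= |Z_k| + O(1 / rho_k) there; 1 / rho_k is geometric, so Z_k is
   bounded and then X_{k+1} - Z_k = O(1 / rho_k) as well. *)

Require Import Defs.
From mathcomp Require Import all_boot all_order all_algebra perm.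
From mathcomp Require Import complex polyrcf ring lra.
From mathcomp Require Import all_classical all_reals all_analysis.

Set Implicit Arguments.
Unset Strict Implicit.
Unset Printing Implicit Defensive.

Local Open Scope classical_set_scope.
Local Open Scope ring_scope.

(** * Spectral theorem for real symmetric matrices *)

(** An eigenvalue [a] exists over the algebraically closed [R[i]]. Since [A] is real and symmetric,
    evaluating [v A] against the conjugate of [v] in two ways gives [a = a^*]. So [a] is a real root
    of the characteristic polynomial, which has an eigenvector over [R]. *)
Lemma symmetric_real_eigenvector (R : rcfType) (n : nat) (A : 'M[R]_n.+1) :
  A^T = A -> exists (v : 'rV[R]_n.+1) (x : R), v != 0 /\ v *m A = x *: v.
Proof.
move=> AT.
pose f := real_complex R.
pose AC := map_mx f A.
have [a] := @eigenvalue_closed _ _ AC (ltn0Sn n).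
move=> eva.
have areal : a = f (complex.Re a).
  have /eigenvalueP[v vA v0] := eva.
  have ACT : AC^T = AC by rewrite /AC map_trmx AT.
  have ACc : map_mx Num.conj AC = AC.
    by apply/matrixP => i j; rewrite !mxE; exact: conjc_real.
  have : a *: (v *m (map_mx Num.conj v)^T) = a^* *: (v *m (map_mx Num.conj v)^T).
    rewrite scalemxAl -vA -mulmxA -{1}ACT -trmx_mul -{1}ACc -map_mxM vA.
    by rewrite map_mxZ linearZ /= -scalemxAr.
  move=> /matrixP/(_ 0 0); rewrite !mxE => /mulIf H.
  have {}H : a = a^*.
    apply: H; rewrite psumr_eq0; last by move=> i _; rewrite !mxE mul_conjC_ge0.
    apply: contra v0 => /allP H; apply/eqP/rowP => i; rewrite mxE.
    have := H i (mem_index_enum _); rewrite !mxE /= mul_conjC_eq0 => /eqP //.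
  by move: H; case: (a) => u w [] /eqP;
  rewrite -addr_eq0 -mulr2n mulrn_eq0 /= => /eqP ->.
move: eva; rewrite areal eigenvalue_root_char /AC -map_char_poly fmorph_root.
rewrite -eigenvalue_root_char => /eigenvalueP[v vA v0].
by exists v, (complex.Re a).
Qed.

(* [H] is the reflection that exchanges the first basis vector and [v]. *)
Lemma householder (R : rcfType) (n : nat) (v : 'rV[R]_n.+1) :
  v *m v^T = 1%:M ->
  exists H : 'M[R]_n.+1, [/\ H^T = H, H *m H = 1%:M & row 0 H = v].
Proof.
move=> vv.
pose e : 'rV[R]_n.+1 := delta_mx 0 0.
have ee : e *m e^T = 1%:M.
  rewrite /e trmx_delta mul_delta_mx; apply/matrixP => i j.
  by rewrite !mxE !ord1 eqxx.
have [u uE] : exists u, u = v - e by exists (v - e).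
pose s := (u *m u^T) 0 0.
have us : u *m u^T = s%:M by rewrite [LHS]mx11_scalar.
(* If [s = 0] then [v = e] and the identity serves; otherwise [c = 2 / s] makes [1 - c u^T u] an
   involution. *)
have [s0|sN0] := eqVneq s 0.
  exists 1%:M; split; rewrite ?trmx1 ?mulmx1 //.
  rewrite row1 -/e; apply/esym/eqP; rewrite -subr_eq0 -uE; apply/eqP/rowP => i.
  move/eqP: s0; rewrite /s mxE psumr_eq0; last first.
    by move=> j _; rewrite !mxE -expr2 sqr_ge0.
  move=> /allP/(_ i (mem_index_enum _)); rewrite !mxE /= mulf_eq0 orbb => /eqP //.
have [c cs] : exists c, c * s = 2 by exists (2 / s); rewrite divfK.
exists (1%:M - c *: (u^T *m u)); split.
- by rewrite linearB /= linearZ /= trmx1 trmx_mul trmxK.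
- rewrite mulmxBl !mulmxBr !mulmx1 mul1mx -scalemxAl -scalemxAr.
  rewrite -mulmxA [u *m (u^T *m u)]mulmxA us mul_scalar_mx -scalemxAr !scalerA.
  rewrite cs.
  apply/matrixP => i j; rewrite !mxE; ring.
- rewrite rowE -/e mulmxBr mulmx1 -scalemxAr mulmxA.
  (* As [e] and [v] are unit vectors, [s = 2 - 2 * v 0 0], while [e u^T = v 0 0 - 1 = - s / 2];
     multiplied by [c] this is [-1]. *)
  have eu : c *: (e *m u^T *m u) = - u.
    have ve : v *m e^T = (v 0 0)%:M.
      rewrite [LHS]mx11_scalar; congr (_%:M).
      rewrite mxE (bigD1 0) //= big1 ?addr0; last first.
        by move=> i i0; rewrite !mxE (negbTE i0) mulr0.
      by rewrite !mxE eqxx mulr1.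
    have ev : e *m v^T = (v 0 0)%:M.
      by rewrite -[LHS]trmxK trmx_mul trmxK ve tr_scalar_mx.
    have s2 : s = 2 - 2 * v 0 0.
      rewrite /s uE linearB /= mulmxBl !mulmxBr vv ee ve ev !mxE /= ; ring.
    rewrite {1}uE linearB /= mulmxBr ev ee.
    have -> : (v 0 0)%:M - 1%:M = (v 0 0 - 1)%:M :> 'M[R]_1.
      by apply/matrixP => i j; rewrite !mxE mulrnBl.
    rewrite mul_scalar_mx scalerA -[RHS]scaleN1r; congr (_ *: _).
    apply: (mulIf sN0); rewrite mulrAC cs s2; ring.
  by rewrite eu uE; apply/rowP => i; rewrite !mxE; ring.
Qed.

(** Deflation: a reflection [H] whose first row is a unit eigenvector splits [H A H] into a 1 by 1
    block and a symmetric block of size [n], which the induction hypothesis diagonalizes. *)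
Theorem symmetric_real_spectral (R : rcfType) (n : nat) (A : 'M[R]_n) :
  A^T = A -> exists (P : 'M[R]_n) (d : 'rV[R]_n),
    P *m P^T = 1%:M /\ A = P^T *m diag_mx d *m P.
Proof.
elim: n A => [|n IHn] A AT.
  by exists 1%:M, 0; split; apply/matrixP => -[].
have [v [x [v0 vA]]] := symmetric_real_eigenvector AT.
pose s := (v *m v^T) 0 0.
have s_gt0 : 0 < s.
  rewrite /s mxE lt_def psumr_eq0 ?sumr_ge0 ?andbT;
    try by move=> i _; rewrite !mxE -expr2 sqr_ge0.
  apply: contra v0 => /allP h; apply/eqP/rowP => i; rewrite mxE.
  by have := h i (mem_index_enum _); rewrite !mxE /= mulf_eq0 orbb => /eqP.
pose v1 := (Num.sqrt s)^-1 *: v.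
have v1A : v1 *m A = x *: v1 by rewrite /v1 -scalemxAl vA !scalerA mulrC.
have v11 : v1 *m v1^T = 1%:M.
  rewrite /v1 linearZ /= -scalemxAl -scalemxAr scalerA [v *m v^T]mx11_scalar -/s.
  rewrite scale_scalar_mx -expr2 exprVn sqr_sqrtr ?ltW // mulVf ?gt_eqF //.
have [H [HT HH H0]] := householder v11.
have [B BHAH] : exists B : 'M[R]_(1 + n), B = H *m A *m H by exists (H *m A *m H).
have BT : B^T = B by rewrite BHAH !trmx_mul HT AT mulmxA.
(* Row 0 of [H] is the eigenvector [v1], so row 0 of [B] is [x] times row 0 of [H *m H = 1].
   Symmetry of [B] then clears the first column. *)
have B0 i : B 0 i = x *+ (i == 0).
  have : row 0 B = x *: delta_mx 0 0.
    rewrite BHAH !row_mul H0 v1A -scalemxAl -H0 -row_mul HH row1 //.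
  by move=> /rowP/(_ i); rewrite !mxE eqxx mulr_natr.
have BE : B = block_mx x%:M 0 0 (drsubmx B).
  rewrite -[LHS]submxK; congr block_mx.
  - by apply/matrixP => i j; rewrite !mxE !ord1 lshift0 B0.
  - by apply/matrixP => i j; rewrite !mxE !ord1 lshift0 B0.
  - apply/matrixP => i j; rewrite -{1}BT !mxE !ord1 lshift0 B0 //.
have [Q [d [QQ dE]]] := IHn (drsubmx B) ltac:(by rewrite trmx_drsub BT).
pose P0 : 'M[R]_(1 + n) := block_mx 1%:M 0 0 Q.
have P0T : P0^T = block_mx 1%:M 0 0 Q^T.
  by rewrite /P0 tr_block_mx !trmx0 trmx1.
have P0P0 : P0 *m P0^T = 1%:M.
  rewrite P0T /P0 mulmx_block !mulmx0 !mul0mx !mulmx1 QQ.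
  by rewrite !addr0 add0r -scalar_mx_block.
pose d0 : 'rV[R]_(1 + n) := row_mx x%:M d.
have P0B : P0^T *m diag_mx d0 *m P0 = B.
  rewrite BE dE P0T /P0 /d0 diag_mx_row !mulmx_block.
  rewrite !mulmx0 !mul0mx !mulmx1 !mul1mx !addr0 !add0r !mul0mx.
  by congr block_mx; apply/matrixP => i j; rewrite !mxE !ord1 eqxx.
exists (P0 *m H), d0; split.
  by rewrite trmx_mul HT mulmxA -[P0 *m H *m H]mulmxA HH mulmx1.
rewrite trmx_mul HT mulmxA -[H *m _ *m _]mulmxA -[H *m _ *m _]mulmxA P0B BHAH.
by rewrite !mulmxA HH mul1mx -mulmxA HH mulmx1.
Qed.

(** * Eigenvalues with multiplicity, read off the characteristic polynomial *)

Lemma char_poly_orthogonal_diag (R : comNzRingType) (n : nat) (P : 'M[R]_n)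
    (d : 'rV[R]_n) :
  P *m P^T = 1%:M ->
  char_poly (P^T *m diag_mx d *m P) = \prod_i ('X - (d 0 i)%:P).
Proof.
move=> PP; have PP' := mulmx1C PP.
have : char_poly_mx (P^T *m diag_mx d *m P) =
    map_mx polyC P^T *m char_poly_mx (diag_mx d) *m map_mx polyC P.
  rewrite /char_poly_mx !map_mxM mulmxBr mulmxBl; congr (_ - _).
  by rewrite mul_mx_scalar -scalemxAl -map_mxM PP' map_mx1 scalemx1.
rewrite /char_poly => ->; rewrite !det_mulmx mulrC mulrA -det_mulmx -map_mxM PP map_mx1.
rewrite det1 mul1r -/(char_poly _) char_poly_trig ?diag_mx_is_trig //.
by apply: eq_bigr => i _; rewrite !mxE eqxx.
Qed.

(** Both lists contain [y] as often as its multiplicity in [p]; a value outside [rootsR p] is no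
    root and has multiplicity 0. With it, the eigenvalue list of a diagonalized matrix is the
    diagonal, up to order. *)
Lemma count_flatten_mup (R : realType) (p : {poly R}) (s : seq R) :
  p = \prod_(y <- s) ('X - y%:P) ->
  perm_eq (flatten [seq nseq (mup x p) x | x <- rootsR p]) s.
Proof.
move=> pE; have p0 : p != 0 by rewrite pE monic_neq0 ?monic_prod_XsubC.
apply/allP => y _ /=; apply/eqP.
rewrite count_flatten -map_comp -(mu_prod_XsubC y s) -pE.
have uR : uniq (rootsR p) by rewrite uniq_roots.
have -> : [seq (count_mem y \o (fun x => nseq (mup x p) x)) x | x <- rootsR p] =
   [seq (if x == y then mup y p else 0)%N | x <- rootsR p].
  apply: eq_map => x /=; rewrite count_nseq /=.
  by case: eqP => [->|]; rewrite ?mul1n ?mul0n.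
rewrite sumnE big_map -big_mkcond /=.
rewrite big_const_seq iter_addn_0 [count _ _](count_uniq_mem y uR).
have [|yR] := boolP (y \in rootsR p); first by rewrite muln1.
rewrite muln0; symmetry; apply: mupNroot; apply: contra yR => ry.
by rewrite -(roots_on_rootsR p0) in_itv.
Qed.

(** * Cauchy-Schwarz and the Frobenius norm *)

(** With [a], [c] the sums of squares and [b] the sum of products, the nonnegative sum of
    [(c * f i - b * g i) ^+ 2] equals [c * (a * c - b ^+ 2)]. If [c = 0], every [g i] vanishes. *)
Lemma sum_cauchy_schwarz (R : realFieldType) (I : finType) (f g : I -> R) :
  (\sum_i f i * g i) ^+ 2 <= (\sum_i f i ^+ 2) * (\sum_i g i ^+ 2).
Proof.
have cge0 : 0 <= \sum_i g i ^+ 2 by apply: sumr_ge0 => i _; exact: sqr_ge0.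
have := cge0; rewrite le_eqVlt => /orP[/eqP c0|c_gt0].
  rewrite -c0 mulr0 big1 ?expr0n // => i _.
  move/esym/eqP: c0; rewrite psumr_eq0 => [/allP h|j _]; last exact: sqr_ge0.
  by have := h i (mem_index_enum _); rewrite /= sqrf_eq0 => /eqP ->; rewrite mulr0.
set a := \sum_i f i ^+ 2; set c := \sum_i g i ^+ 2 in c_gt0 *.
set b := \sum_i f i * g i.
have : 0 <= \sum_i (c * f i - b * g i) ^+ 2.
  by apply: sumr_ge0 => i _; exact: sqr_ge0.
have -> : \sum_i (c * f i - b * g i) ^+ 2 = c * (a * c - b ^+ 2).
  transitivity (\sum_i (c ^+ 2 * f i ^+ 2 + - (2 * c * b) * (f i * g i) +
    b ^+ 2 * g i ^+ 2)).
    by apply: eq_bigr => i _; ring.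
  by rewrite !big_split /= -!mulr_sumr -/a -/b -/c; ring.
by rewrite pmulr_rge0 // subr_ge0.
Qed.

Lemma frobenius_ge0 (R : realType) (m n : nat) (A : 'M[R]_(m, n)) :
  0 <= frobenius A.
Proof. exact: sqrtr_ge0. Qed.

Lemma frobenius_sqr (R : realType) (m n : nat) (A : 'M[R]_(m, n)) :
  frobenius A ^+ 2 = \sum_i \sum_j A i j ^+ 2.
Proof.
rewrite sqr_sqrtr // sumr_ge0 // => i _.
by rewrite sumr_ge0 // => j _; exact: sqr_ge0.
Qed.

Lemma frobenius_row_sqr (R : realType) (n : nat) (v : 'rV[R]_n) :
  frobenius v ^+ 2 = \sum_j v 0 j ^+ 2.
Proof. by rewrite frobenius_sqr big_ord1. Qed.

Lemma frobenius_eq0 (R : realType) (m n : nat) (A : 'M[R]_(m, n)) :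
  (frobenius A == 0) = (A == 0).
Proof.
apply/eqP/eqP => [/(congr1 (fun x => x ^+ 2))|->].
  rewrite frobenius_sqr expr0n /= => /eqP.
  rewrite pair_bigA psumr_eq0 => [/allP h|ij _]; last exact: sqr_ge0.
  apply/matrixP => i j; rewrite mxE; apply/eqP.
  by have := h (i, j) (mem_index_enum _); rewrite /= sqrf_eq0.
by rewrite /frobenius big1 ?sqrtr0// => i _; rewrite big1// => j _; rewrite mxE expr0n.
Qed.

Lemma frobenius_tr (R : realType) (m n : nat) (A : 'M[R]_(m, n)) :
  frobenius A^T = frobenius A.
Proof.
rewrite /frobenius exchange_big /=; congr Num.sqrt.
by apply: eq_bigr => i _; apply: eq_bigr => j _; rewrite mxE.
Qed.

Lemma ler_frobeniusD (R : realType) (m n : nat) (A B : 'M[R]_(m, n)) :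
  frobenius (A + B) <= frobenius A + frobenius B.
Proof.
rewrite -ler_sqr ?nnegrE ?addr_ge0 ?frobenius_ge0 //.
rewrite sqrrD !frobenius_sqr !pair_bigA /=.
have -> : \sum_p (A + B) p.1 p.2 ^+ 2 = \sum_p A p.1 p.2 ^+ 2 +
    (\sum_p A p.1 p.2 * B p.1 p.2) *+ 2 + \sum_p B p.1 p.2 ^+ 2.
  by rewrite -sumrMnl -!big_split; apply: eq_bigr => p _; rewrite mxE sqrrD.
rewrite lerD2r lerD2l lerMn2r /=; apply: le_trans (ler_norm _) _.
rewrite -ler_sqr ?nnegrE ?mulr_ge0 ?frobenius_ge0 // real_normK ?num_real //.
by rewrite exprMn !frobenius_sqr !pair_bigA /= sum_cauchy_schwarz.
Qed.

Lemma ler_frobeniusM (R : realType) (m n p : nat) (A : 'M[R]_(m, n))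
    (B : 'M[R]_(n, p)) :
  frobenius (A *m B) <= frobenius A * frobenius B.
Proof.
rewrite -ler_sqr ?nnegrE ?mulr_ge0 ?frobenius_ge0 // exprMn !frobenius_sqr.
rewrite mulr_suml ler_sum // => i _.
rewrite [X in _ * X]exchange_big mulr_sumr ler_sum // => k _.
by rewrite mxE sum_cauchy_schwarz.
Qed.

Lemma ler_entry_frobenius (R : realType) (m n : nat) (A : 'M[R]_(m, n)) i j :
  `|A i j| <= frobenius A.
Proof.
rewrite -ler_sqr ?nnegrE ?frobenius_ge0 // real_normK ?num_real // frobenius_sqr.
rewrite pair_bigA (bigD1 (i, j)) //= lerDl sumr_ge0 // => ij _; exact: sqr_ge0.
Qed.

(** The left side is the quadratic form of [Z^T Z] at [v], which is diagonal in the coordinates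
    [v *m Q^T]. *)
Lemma frobenius_gram (R : realType) (m n : nat) (Z : 'M[R]_(m, n))
    (Q : 'M[R]_n) (e : 'rV[R]_n) (v : 'rV[R]_n) :
  Z^T *m Z = Q^T *m diag_mx e *m Q ->
  frobenius (v *m Z^T) ^+ 2 = \sum_j e 0 j * (v *m Q^T) 0 j ^+ 2.
Proof.
move=> ZE; rewrite frobenius_row_sqr.
have -> : \sum_j (v *m Z^T) 0 j ^+ 2 = (v *m Z^T *m (v *m Z^T)^T) 0 0.
  by rewrite [RHS]mxE; apply: eq_bigr => j _; rewrite [_^T j 0]mxE -expr2.
rewrite trmx_mul trmxK mulmxA -[v *m _ *m _]mulmxA ZE !mulmxA.
rewrite -mulmxA.
have -> : Q *m v^T = (v *m Q^T)^T by rewrite trmx_mul trmxK.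
rewrite mul_mx_diag mxE; apply: eq_bigr => j _.
by rewrite [_^T j 0]mxE [X in X * _]mxE; ring.
Qed.

(** Parseval's identity, obtained from [frobenius_gram] with the identity matrix as [Z] and all
    eigenvalues 1. *)
Lemma frobenius_orthogonal (R : realType) (n : nat) (Q : 'M[R]_n)
    (v : 'rV[R]_n) :
  Q *m Q^T = 1%:M -> frobenius v ^+ 2 = \sum_j (v *m Q^T) 0 j ^+ 2.
Proof.
move=> QQ; have QE : (1%:M)^T *m 1%:M = Q^T *m diag_mx (const_mx 1) *m Q.
  by rewrite diag_const_mx trmx1 !mulmx1 (mulmx1C QQ).
rewrite -[v in LHS]mulmx1 -[1%:M in LHS]trmx1 (frobenius_gram _ QE).
by apply: eq_bigr => j _; rewrite mxE mul1r.
Qed.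

(** * Singular values and Weyl's inequality *)

(** Links the sorted list of roots to an orthogonal diagonalization: the rows of [P] are permuted so
    that the eigenvalues appear in the order of the singular values. *)
Lemma singular_value_spectral (R : realType) (m n : nat) (Z : 'M[R]_(m, n)) :
  exists Q : 'M[R]_n, [/\ Q *m Q^T = 1%:M,
    Z^T *m Z = Q^T *m diag_mx (\row_i singular_value Z i ^+ 2) *m Q,
    forall i : nat, 0 <= singular_value Z i
  & forall i j : nat, (i <= j)%N -> (j < n)%N ->
      singular_value Z j <= singular_value Z i].
Proof.
have [P [d [PP ZE]]] : exists (P : 'M[R]_n) (d : 'rV[R]_n),
    P *m P^T = 1%:M /\ Z^T *m Z = P^T *m diag_mx d *m P.
  by apply: symmetric_real_spectral; rewrite trmx_mul trmxK.
(* At row [i] of [P] the quadratic form of [Z^T Z] takes the value [d 0 i], and it is a squared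
   norm. *)
have d_ge0 i : 0 <= d 0 i.
  have := sqr_ge0 (frobenius (row i P *m Z^T)); rewrite (frobenius_gram _ ZE).
  rewrite -row_mul PP (bigD1 i) //= big1 => [|j ji].
    by rewrite !mxE eqxx expr1n mulr1 addr0.
  by rewrite !mxE eq_sym (negbTE ji) expr0n mulr0.
pose t := [tuple Num.sqrt (d 0 i) | i < n].
have svt : perm_eq (singular_values Z) t.
  rewrite /singular_values perm_sort.
  have -> : tval t = [seq Num.sqrt x | x <- [seq d 0 i | i <- enum 'I_n]].
    by rewrite -map_comp.
  apply: perm_map; apply: count_flatten_mup.
  by rewrite ZE char_poly_orthogonal_diag // big_map big_enum.
have [p pE] := tuple_permP svt.
have svE (i : 'I_n) : singular_value Z i = Num.sqrt (d 0 (p i)).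
  by rewrite /singular_value pE -tnth_nth !tnth_mktuple.
have size_sv : size (singular_values Z) = n by rewrite (perm_size svt) size_tuple.
exists (row_perm p P); split.
- rewrite row_permE trmx_mul mulmxA -[_ *m P *m _]mulmxA PP mulmx1.
  by rewrite tr_perm_mx -perm_mxM mulgV perm_mx1.
- rewrite ZE !mul_mx_diag; apply/matrixP => i j; rewrite [LHS]mxE [RHS]mxE.
  rewrite (reindex_perm p) /=; apply: eq_bigr => k _.
  by rewrite !mxE svE sqr_sqrtr.
(* Past the end of the list [nth] returns the default 0. *)
- move=> i; have [ilt|ige] := ltnP i n; last first.
    by rewrite /singular_value nth_default ?size_sv.
  by rewrite (svE (Ordinal ilt)) sqrtr_ge0.
- move=> i j ij jn; apply: (@sorted_leq_nth _ (fun x y : R => x >= y)) => //.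
  + by move=> y x z /= yx zy; exact: le_trans zy yx.
  + by apply: sort_sorted => x y; exact: ge_total.
  + by rewrite inE size_sv (leq_ltn_trans ij).
  + by rewrite inE size_sv.
Qed.

(** Dimension count: [v] is a combination of the first [i + 1] rows of [P], subject to [i] linear
    conditions. The matrix [B] of these conditions has one row more than columns, hence a nonzero
    left kernel vector [u]. *)
Lemma exists_common_vector (F : fieldType) (n : nat) (P Q : 'M[F]_n)
    (i : nat) : (i < n)%N -> P *m P^T = 1%:M ->
  exists v : 'rV[F]_n, [/\ v != 0,
    forall j : 'I_n, (i < j)%N -> (v *m P^T) 0 j = 0
  & forall j : 'I_n, (j < i)%N -> (v *m Q^T) 0 j = 0].
Proof.
move=> lin PP.
pose f : 'I_i.+1 -> 'I_n := widen_ord lin.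
pose g : 'I_i -> 'I_n := widen_ord (ltnW lin).
pose B := colsub g (rowsub f P *m Q^T).
pose u := nz_row (kermx B).
have u0 : u != 0.
  rewrite nz_row_eq0 -mxrank_eq0 mxrank_ker -lt0n subn_gt0.
  by rewrite (leq_ltn_trans (rank_leq_col B)).
have uB : u *m B = 0 by apply/sub_kermxP; exact: nz_row_sub.
pose v := u *m rowsub f P.
have vP j : (v *m P^T) 0 j = \sum_k u 0 k * (f k == j)%:R.
  rewrite /v -mulmxA mul_rowsub_mx PP mxE; apply: eq_bigr => k _.
  by rewrite !mxE.
exists v; split.
- apply: contra u0 => /eqP vE; apply/eqP/rowP => k; rewrite [RHS]mxE.
  have := vP (f k); rewrite vE mul0mx mxE => ->.
  rewrite (bigD1 k) //= eqxx mulr1 big1 ?addr0 // => l lk.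
  by rewrite -(inj_eq val_inj) /= (inj_eq val_inj) (negbTE lk) mulr0.
- move=> j ij; rewrite vP big1 // => k _.
  case: eqP => [fk|]; last by rewrite mulr0.
  by move: ij; rewrite -fk /= ltnNge -ltnS ltn_ord.
- move=> j ji; have := congr1 (fun M : 'rV_i => M 0 (Ordinal ji)) uB.
  rewrite /B mulmx_colsub mulmxA mxE [RHS]mxE => <-.
  by congr (_ 0 _); apply: val_inj.
Qed.

(* Courant-Fischer: some [v != 0] lies both in the span of the first i+1 right
   singular vectors of [D] and in the span of those of [Z] from index i on. *)
Theorem singular_value_weyl (R : realType) (m n : nat) (D Z : 'M[R]_(m, n))
    (i : nat) : (i < n)%N ->
  singular_value D i <= singular_value Z i + frobenius (D - Z).
Proof.
move=> lin.
have [P [PP DE D0 Dle]] := singular_value_spectral D.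
have [Q [QQ ZE Z0 Zle]] := singular_value_spectral Z.
have [v [v0 vP vQ]] := exists_common_vector Q lin PP.
have v_gt0 : 0 < frobenius v by rewrite lt_def frobenius_eq0 v0 frobenius_ge0.
rewrite -(ler_pM2r v_gt0) mulrDl.
(* Along [P] only the coordinates [j <= i] of [v] survive, where the singular values of [D] are at
   least the [i]-th. Along [Q], for [Zv], only [j >= i] survive, which gives the opposite bound for
   [Z]. *)
have Dv : singular_value D i * frobenius v <= frobenius (v *m D^T).
  rewrite -ler_sqr ?nnegrE ?mulr_ge0 ?frobenius_ge0 // exprMn.
  rewrite (frobenius_gram _ DE) (frobenius_orthogonal _ PP) mulr_sumr.
  apply: ler_sum => j _.
  have [ji|/vP ->] := leqP j i; last by rewrite expr0n !mulr0.
  by rewrite ler_wpM2r ?sqr_ge0 // mxE ler_sqr ?nnegrE // Dle.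
have Zv : frobenius (v *m Z^T) <= singular_value Z i * frobenius v.
  rewrite -ler_sqr ?nnegrE ?mulr_ge0 ?frobenius_ge0 // exprMn.
  rewrite (frobenius_gram _ ZE) (frobenius_orthogonal _ QQ) mulr_sumr.
  apply: ler_sum => j _.
  have [ij|/vQ ->] := leqP i j; last by rewrite expr0n !mulr0.
  by rewrite ler_wpM2r ?sqr_ge0 // mxE ler_sqr ?nnegrE // Zle.
apply: le_trans Dv _.
have -> : v *m D^T = v *m Z^T + v *m (D - Z)^T.
  by rewrite -mulmxDr linearB /= addrC subrK.
apply: le_trans (ler_frobeniusD _ _) _; apply: lerD => //.
by rewrite mulrC -(frobenius_tr (D - Z)) ler_frobeniusM.
Qed.

(** * The two minimization steps: proximal bound and entrywise form of the X-update *)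

Lemma weighted_nuclear_norm_lipschitz (R : realType) (m n : nat)
    (w : 'rV[R]_(minn m n)) (D Z : 'M[R]_(m, n)) :
  (forall i, 0 <= w 0 i) ->
  weighted_nuclear_norm w D <=
    weighted_nuclear_norm w Z + (\sum_i w 0 i) * frobenius (D - Z).
Proof.
move=> w0; rewrite mulr_suml -big_split ler_sum //= => i _.
rewrite -mulrDr ler_wpM2l // singular_value_weyl //.
by rewrite (leq_trans (ltn_ord i)) ?geq_minr.
Qed.

Lemma proximal_residual_bound (R : realType) (m n : nat)
    (w : 'rV[R]_(minn m n)) (r : R) (D Z : 'M[R]_(m, n)) :
  (forall i, 0 <= w 0 i) -> 0 < r ->
  is_global_minimizer (fun V : 'M[R]_(m, n) =>
    r / 2 * frobenius (V - D) ^+ 2 + weighted_nuclear_norm w V) Z ->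
  r * frobenius (D - Z) <= 2 * \sum_i w 0 i.
Proof.
move=> w0 r0 /(_ D); rewrite /= subrr.
have /eqP -> : frobenius (0 : 'M[R]_(m, n)) == 0 by rewrite frobenius_eq0.
rewrite expr0n mulr0 add0r => ZD.
have := le_trans ZD (weighted_nuclear_norm_lipschitz D Z w0).
rewrite addrC lerD2l.
have -> : frobenius (Z - D) = frobenius (D - Z).
  rewrite /frobenius; congr Num.sqrt; apply: eq_bigr => i _; apply: eq_bigr => j _.
  by rewrite !mxE -sqrrN opprB.
(* What remains is [r / 2 * F ^+ 2 <= L * F] with [F = frobenius (D - Z)]; dividing by [F] requires
   [F > 0], so [F = 0] is treated apart. *)
have := frobenius_ge0 (D - Z); rewrite le_eqVlt => /orP[/eqP <- _|F0].
  by rewrite mulr0 mulr_ge0 // sumr_ge0.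
rewrite expr2 mulrA ler_pM2r // => h; rewrite -ler_pdivrMl // mulrA.
by rewrite [2^-1 * r]mulrC.
Qed.

Lemma channel_weight_gram (R : realType) (p : nat) (sr sg sb : R) :
  exists2 c : 'rV[R]_(3 * p ^ 2), forall i, 0 <= c 0 i
    & (channel_weight_mx p sr sg sb)^T *m channel_weight_mx p sr sg sb =
      diag_mx c.
Proof.
have [b bE] : exists b, channel_weight_mx p sr sg sb = diag_mx b.
  rewrite /channel_weight_mx -!diag_const_mx -!diag_mx_row.
  (* The diagonal is generalized first, so that its type follows when the dimension cast is
     eliminated. *)
  move: (row_mx _ _); case: _ / (three_channels _) => d.
  by exists d; rewrite castmx_id.
exists (\row_i b 0 i ^+ 2) => [i|]; first by rewrite mxE sqr_ge0.
by rewrite bE tr_diag_mx mulmx_diag; congr diag_mx.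
Qed.

(** The diagonal entries [c 0 i + r] are positive, so the matrix is invertible and the system
    decouples into one scalar equation per entry. *)
Lemma invmx_diag_mulmx_entry (R : realFieldType) (m n : nat) (c : 'rV[R]_m)
    (r : R) (X B : 'M[R]_(m, n)) :
  (forall i, 0 <= c 0 i) -> 0 < r ->
  X = invmx (diag_mx c + r%:M) *m B ->
  forall i j, (c 0 i + r) * X i j = B i j.
Proof.
move=> c0 r0 XE i j.
have DE : diag_mx c + r%:M = diag_mx (\row_k (c 0 k + r)).
  by apply/matrixP => k l; rewrite !mxE -mulrnDl.
have Du : diag_mx c + r%:M \in unitmx.
  rewrite unitmxE unitfE DE det_diag; apply/prodf_neq0 => k _.
  by rewrite mxE gt_eqF // ltr_wpDl.
have : (diag_mx c + r%:M) *m X = B by rewrite XE mulKVmx.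
by rewrite DE mul_diag_mx => /matrixP/(_ i j); rewrite !mxE.
Qed.

(** * Convergence criteria *)

Lemma frobenius_cvg0 (R : realType) (m n : nat) (U : nat -> 'M[R]_(m, n)) :
  (forall i j, (fun k => U k i j) @ \oo --> (0 : R)) ->
  (fun k => frobenius (U k)) @ \oo --> (0 : R).
Proof.
move=> U0; rewrite -[X in _ --> X](@sqrtr0 R).
apply: (continuous_cvg _ (@sqrt_continuous R 0)).
(* The limit 0 is written in the shape of the double sum of squares, so that limits pass through
   sums and products termwise. *)
rewrite [X in _ --> X](_ : 0 = \sum_(i < m) \sum_(j < n) 0 * 0); last first.
  by rewrite big1 // => i _; rewrite big1 // => j _; rewrite mulr0.
have addc : continuous (fun x : R * R => x.1 + x.2) by exact: add_continuous.
apply: (cvg_big addc (Fa := fun=> \sum_(j < n) 0 * 0)) => i _.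
apply: (cvg_big addc (Fa := fun=> 0 * 0)) => j _.
by apply: cvgM; exact: U0.
Qed.

Lemma cvg0_of_geometric_bound (R : realType) (u : nat -> R) (K rho0 mu : R) :
  0 < rho0 -> 1 < mu -> (forall k, `|u k| <= K / (rho0 * mu ^+ k)) ->
  u @ \oo --> (0 : R).
Proof.
move=> rho0_gt0 mu_gt1 uK; apply/norm_cvg0P.
apply: (@squeeze_cvgr _ _ _ _ (cst 0) (geometric (K / rho0) mu^-1)).
- near=> k; rewrite normr_ge0 /=; apply: le_trans (uK k) _.
  by rewrite /= invfM exprVn mulrA.
- exact: cvg_cst.
- apply: cvg_geometric; rewrite normfV invf_lt1 ?normr_gt0 ?gt_eqF
    ?(lt_trans _ mu_gt1) //.
  exact: lt_le_trans mu_gt1 (ler_norm _).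
Unshelve. all: by end_near. Qed.

(** * The iteration in a single matrix entry, with bounded multipliers *)

Section ScalarIteration.
Variables (R : realType) (c y C rho0 mu : R) (x z a : nat -> R).
Hypotheses (c_ge0 : 0 <= c) (rho0_gt0 : 0 < rho0) (mu_gt1 : 1 < mu).
Let rho k := rho0 * mu ^+ k.
Hypotheses (z0 : z 0%N = 0) (a_bounded : forall k, `|a k| <= C).
Hypothesis xE : forall k,
  (c + rho k / 2) * x k.+1 = c * y + rho k / 2 * z k - 2^-1 * a k.
Hypothesis aE : forall k, a k.+1 = a k + rho k * (x k.+1 - z k.+1).

Let rho_gt0 k : 0 < rho k.
Proof. by rewrite mulr_gt0 ?exprn_gt0 // (lt_trans _ mu_gt1). Qed.

Let C_ge0 : 0 <= C.
Proof. exact: le_trans (normr_ge0 (a 0)) (a_bounded 0). Qed.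

Lemma scalar_primal_residual k : `|x k.+1 - z k.+1| <= 2 * C / rho k.
Proof.
rewrite ler_pdivlMr // -{1}[rho k]gtr0_norm // -normrM.
have -> : (x k.+1 - z k.+1) * rho k = a k.+1 - a k by rewrite aE; ring.
apply: le_trans (ler_normB _ _) _.
by rewrite mulr_natl mulr2n lerD.
Qed.

(** Subtracting [(c + rho k / 2) * z k] from [xE] cancels the terms in [rho k]. The nonnegative term
    [c * |x - z|] is then dropped and the rest is doubled. *)
Lemma scalar_dual_residual k :
  `|x k.+1 - z k| <= (2 * c * `|y| + 2 * c * `|z k| + C) / rho k.
Proof.
have d_gt0 : 0 < c + rho k / 2 by rewrite ltr_wpDl // divr_gt0.
have E : (c + rho k / 2) * (x k.+1 - z k) = c * y - c * z k - 2^-1 * a k.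
  by rewrite mulrBr xE; ring.
have le1 : (c + rho k / 2) * `|x k.+1 - z k| <= c * `|y| + c * `|z k| + 2^-1 * C.
  rewrite -{1}(gtr0_norm d_gt0) -normrM E.
  apply: le_trans (ler_normB _ _) _; apply: lerD.
    apply: le_trans (ler_normB _ _) _.
    by rewrite !normrM (ger0_norm c_ge0).
  by rewrite normrM ger0_norm ?invr_ge0 // ler_wpM2l ?invr_ge0.
rewrite ler_pdivlMr //.
have := mulr_ge0 c_ge0 (normr_ge0 (x k.+1 - z k)).
lra.
Qed.

Lemma scalar_z_bounded : exists B, forall k, `|z k| <= B.
Proof.
have mu_gt0 : 0 < mu by rewrite (lt_trans _ mu_gt1).
have q_gt0 : 0 < mu - 1 by rewrite subr_gt0.
(* Of this, [2 * c * |y| + C] comes from the x-update and [2 * C] from the primal residual. *)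
pose K := 2 * c * `|y| + 3 * C.
have K_ge0 : 0 <= K by rewrite addr_ge0 ?mulr_ge0.
have zS k : `|z k.+1| <= `|z k| + K / rho k.
  have d_gt0 : 0 < c + rho k / 2 by rewrite ltr_wpDl // divr_gt0.
  have xle : `|x k.+1| <= `|z k| + (2 * c * `|y| + C) / rho k.
    have : (c + rho k / 2) * `|x k.+1| <= c * `|y| + rho k / 2 * `|z k|
        + 2^-1 * C.
      rewrite -{1}(gtr0_norm d_gt0) -normrM xE.
      apply: le_trans (ler_normB _ _) _; apply: lerD.
        apply: le_trans (ler_normD _ _) _.
        rewrite normrM [X in _ + X <= _]normrM (ger0_norm c_ge0).
        by rewrite [`|rho k / 2|]gtr0_norm // divr_gt0.
      by rewrite normrM ger0_norm ?invr_ge0 // ler_wpM2l ?invr_ge0.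
    move=> xle; rewrite -lerBlDl ler_pdivlMr //.
    have := mulr_ge0 c_ge0 (normr_ge0 (x k.+1)).
    lra.
  have -> : z k.+1 = x k.+1 - (x k.+1 - z k.+1) by ring.
  apply: le_trans (ler_normB _ _) _.
  have := scalar_primal_residual k; rewrite /K.
  have -> : (2 * c * `|y| + 3 * C) / rho k =
    (2 * c * `|y| + C) / rho k + 2 * C / rho k by ring.
  lra.
(* [S] is the sum of the geometric series of all increments [K / rho k]. *)
pose S := K * mu / (rho0 * (mu - 1)).
(* The bound is the exact partial sum of the increments, so the induction step closes with an
   equality. *)
have zle k : `|z k| <= S * (1 - mu ^- k).
  elim: k => [|k IHk]; first by rewrite z0 normr0 expr0 invr1 subrr mulr0.
  apply: le_trans (zS k) _; apply: le_trans (lerD IHk (lexx _)) _.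
  rewrite le_eqVlt; apply/orP; left; apply/eqP; rewrite /S /rho exprS; field.
  by rewrite !gt_eqF ?exprn_gt0.
exists S => k; apply: le_trans (zle k) _.
have S_ge0 : 0 <= S by rewrite /S divr_ge0 ?mulr_ge0 // ltW.
by rewrite ler_piMr // gerBl invr_ge0 exprn_ge0 // ltW.
Qed.

Lemma scalar_primal_residual_cvg0 :
  (fun k => x k.+1 - z k.+1) @ \oo --> (0 : R).
Proof. exact: (cvg0_of_geometric_bound _ _ scalar_primal_residual). Qed.

Lemma scalar_dual_residual_cvg0 : (fun k => x k.+1 - z k) @ \oo --> (0 : R).
Proof.
(* Bounding [z] by [B] makes the numerator of the dual bound independent of [k]. *)
have [B zB] := scalar_z_bounded.
apply: (cvg0_of_geometric_bound (K := 2 * c * `|y| + 2 * c * B + C)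
  rho0_gt0 mu_gt1) => k.
apply: le_trans (scalar_dual_residual k) _.
by rewrite ler_pM2r ?invr_gt0 // lerD2r lerD2l ler_wpM2l ?mulr_ge0.
Qed.

End ScalarIteration.

Theorem theorem1 (R : realType) (p M : nat) (hp : (1 <= p)%N) (hM : (1 <= M)%N)
    (Y : 'M[R]_(3 * p ^ 2, M))
    (sr sg sb : R) (hsr : 0 < sr) (hsg : 0 < sg) (hsb : 0 < sb)
    (w : 'rV[R]_(minn (3 * p ^ 2) M))
    (hw_ge0 : forall i, 0 <= w 0 i)
    (hw_sorted : forall i j : 'I_(minn (3 * p ^ 2) M),
        (i <= j)%N -> w 0 i <= w 0 j)
    (rho0 mu : R) (hrho0 : 0 < rho0) (hmu : 1 < mu)
    (X Z A : nat -> 'M[R]_(3 * p ^ 2, M)) (rho : nat -> R)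
    (hadmm : admm_iteration Y (channel_weight_mx p sr sg sb) w rho0 mu
               X Z A rho) :
  [/\ (fun k : nat => frobenius (X k.+1 - Z k.+1)) @ \oo --> (0 : R),
      (fun k : nat => frobenius (X k.+1 - X k)) @ \oo --> (0 : R)
    & (fun k : nat => frobenius (Z k.+1 - Z k)) @ \oo --> (0 : R)].
Proof.
case: hadmm => X0 Z0 A0 rho_0 XS ZS AS rhoS.
have rhoE k : rho k = rho0 * mu ^+ k.
  by elim: k => [|k IHk]; rewrite ?expr0 ?mulr1 // rhoS IHk exprS mulrCA.
have rho_gt0 k : 0 < rho k.
  by rewrite rhoE mulr_gt0 ?exprn_gt0 // (lt_trans _ hmu).
have A_bounded i j k : `|A k i j| <= 2 * \sum_l w 0 l.
  case: k => [|k]; first by rewrite A0 mxE normr0 mulr_ge0 ?sumr_ge0.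
  (* The multiplier update is [rho k] times the proximal residual; the index 0 is apart because
     [A 0] comes from no update. *)
  have -> : A k.+1 = rho k *: ((X k.+1 + (rho k)^-1 *: A k) - Z k.+1).
    rewrite AS addrAC [RHS]scalerDr scalerA divff ?gt_eqF // scale1r.
    exact: addrC.
  rewrite mxE normrM (gtr0_norm (rho_gt0 k)).
  apply: le_trans (proximal_residual_bound hw_ge0 (rho_gt0 k) (ZS k)).
  by rewrite ler_pM2l // ler_entry_frobenius.
have [c c_ge0 WE] := channel_weight_gram p sr sg sb.
have xE i j k : (c 0 i + rho0 * mu ^+ k / 2) * X k.+1 i j =
    c 0 i * Y i j + rho0 * mu ^+ k / 2 * Z k i j - 2^-1 * A k i j.
  rewrite -rhoE; have := XS k; rewrite WE => /invmx_diag_mulmx_entry -> //.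
    by rewrite mul_diag_mx !mxE.
  by rewrite divr_gt0.
have aE i j k : A k.+1 i j =
    A k i j + rho0 * mu ^+ k * (X k.+1 i j - Z k.+1 i j).
  by rewrite -rhoE AS !mxE.
have z0 i j : Z 0%N i j = 0 by rewrite Z0 mxE.
have primal i j := scalar_primal_residual_cvg0 (x := fun k => X k i j)
  (z := fun k => Z k i j) hrho0 hmu (A_bounded i j) (aE i j).
have dual i j := scalar_dual_residual_cvg0 (x := fun k => X k i j)
  (z := fun k => Z k i j) (c_ge0 i) hrho0 hmu (z0 i j) (A_bounded i j)
  (xE i j) (aE i j).
split; apply: frobenius_cvg0 => i j.
- under eq_fun do rewrite !mxE; exact: primal.
(* Here [X k.+1 - X k] is the dual residual minus the primal residual of the previous index, hence
   the shift. *)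
- have xz : (fun k => X k i j - Z k i j) @ \oo --> (0 : R).
    by rewrite -cvg_shiftS; exact: primal.
  have h := cvgB (dual i j) xz; rewrite subrr in h.
  rewrite (_ : (fun k => _) = (fun k => X k.+1 i j - Z k i j) \-
    (fun k => X k i j - Z k i j)); first exact: h.
  by apply/funext => k; rewrite !mxE /=; ring.
(* Here [Z k.+1 - Z k] is the dual residual minus the primal residual of the same index. *)
- have h := cvgB (dual i j) (primal i j); rewrite subrr in h.
  rewrite (_ : (fun k => _) = (fun k => X k.+1 i j - Z k i j) \-
    (fun k => X k.+1 i j - Z k.+1 i j)); first exact: h.
  by apply/funext => k; rewrite !mxE /=; ring.
Qed.
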